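(* Let $\left({\boldsymbol{z} \atop \boldsymbol{k}}\right)$ be a pair satisfying the dual condition, and let $\left({\boldsymbol{z}' \atop \boldsymbol{k}'}\right)$ be its dual pair. Then, as $N\to\infty$, \[ \mathrm{I}_{\boldsymbol{k}'}^{(N)}(\boldsymbol{z}')=(-1)^{\mathrm{wt}(\boldsymbol{k})}\mathrm{I}_{\boldsymbol{k}}^{(N)}(\boldsymbol{z})+O(N^{-1}\log^{\mathrm{wt}(\boldsymbol{k})}N). \]
   Context: An index is a tuple of positive integers (possibly empty, $\varnothing$); $\mathrm{dep}$ = length, $\mathrm{wt}$ = sum of entries. An index is admissible if it is empty or its last entry is $\ge2$. For an index $\boldsymbol{k}=(k_1,\dots,k_r)$ and complex $\boldsymbol{z}=(z_1,\dots,z_r)$, $\mathrm{I}_{\boldsymbol{k}}^{(N)}(\boldsymbol{z})\coloneqq\sum\prod_{j=1}^r\frac{1}{(n_{j,1}-Nz_j)n_{j,2}\cdots n_{j,k_j}}$ over integers with $0< n_{j,1}\leq\cdots\leq n_{j,k_j}< N$ ($1\le j\le r$) and $n_{j,k_j}<n_{j+1,1}$ ($1\le j<r$). Dual index: a nonempty admissible index is uniquely $\boldsymbol{k}=(\{1\}^{a_1-1},b_1+1,\dots,\{1\}^{a_h-1},b_h+1)$ with $h,a_i,b_i\ge1$ ($\{1\}^m$ means $m$ repeated 1's); set $\boldsymbol{k}^\dagger\coloneqq(\{1\}^{b_h-1},a_h+1,\dots,\{1\}^{b_1-1},a_1+1)$, and $\varnothing^\dagger=\varnothing$. Let $\mathbb{B}\coloneqq\{z\in\mathbb{C}\mid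 |z|\ge1,|1-z|\ge1\}\cup\{1\}$. A pair $\left({\boldsymbol{z}\atop\boldsymbol{k}}\right)$ (nonempty index $\boldsymbol{k}$ of depth $r$, $\boldsymbol{z}\in\mathbb{C}^r$) satisfies the dual condition if all $z_i\in\mathbb{B}$ and, when $\boldsymbol{k}$ is not admissible, $z_r\ne1$. Such a pair is uniquely written as $\boldsymbol{k}=(\boldsymbol{l}_1,\{1\}^{a_1-1},b_1,\dots,\boldsymbol{l}_d,\{1\}^{a_d-1},b_d,\boldsymbol{l}_{d+1})$, $\boldsymbol{z}=(\{1\}^{r_1},\{1\}^{a_1-1},w_1,\dots,\{1\}^{r_d},\{1\}^{a_d-1},w_d,\{1\}^{r_{d+1}})$ (entries aligned position-wise), where $d\ge0$, $a_j,b_j\ge1$, $w_j\ne1$, $\boldsymbol{l}_j$ admissible (possibly empty), $r_j=\mathrm{dep}(\boldsymbol{l}_j)$. Its dual pair $\left({\boldsymbol{z}'\atop\boldsymbol{k}'}\right)$ is given by $\boldsymbol{k}'=(\boldsymbol{l}_{d+1}^\dagger,\{1\}^{b_d-1},a_d,\boldsymbol{l}_d^\dagger,\dots,\{1\}^{b_1-1},a_1,\boldsymbol{l}_1^\dagger)$ and $\boldsymbol{z}'=(\{1\}^{s_{d+1}},\{1\}^{b_d-1},1-w_d,\{1\}^{s_d},\dots,\{1\}^{b_1-1},1-w_1,\{1\}^{s_1})$, with $s_j=\mathrm{dep}(\boldsymbol{l}_j^\dagger)$. *)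

(* Defs.v *)
From HB Require Import structures.
From mathcomp Require Import all_boot all_order all_algebra.
From mathcomp Require Import complex.
From mathcomp Require Import all_classical all_reals all_analysis.

Set Implicit Arguments.
Unset Strict Implicit.
Unset Printing Implicit Defensive.

Import Order.TTheory GRing.Theory Num.Theory.
Import numFieldNormedType.Exports.

Local Open Scope ring_scope.
Local Open Scope complex_scope.

Definition is_index (k : seq nat) : bool := all (leq 1) k.

(* The default value 2 makes the empty index admissible. *)
Definition admissible (k : seq nat) : bool := is_index k && (2 <= last 2 k)%N.

Definition wt (k : seq nat) : nat := sumn k.

(* The index ({1}^{a_1-1}, b_1+1, .., {1}^{a_h-1}, b_h+1) attached to
   (a_1,b_1), .., (a_h,b_h). *)
Definition ab_index (s : seq (nat * nat)) : seq nat :=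
  flatten [seq rcons (nseq p.1.-1 1%N) p.2.+1 | p <- s].

Definition pos_pair (p : nat * nat) : bool := (0 < p.1)%N && (0 < p.2)%N.

(* Inverse of [ab_index] on admissible indices; the accumulator [a] is one plus
   the number of 1's read since the last entry greater than 1. *)
Fixpoint index_ab_rec (a : nat) (k : seq nat) : seq (nat * nat) :=
  if k is x :: k' then
    if x == 1%N then index_ab_rec a.+1 k' else (a, x.-1) :: index_ab_rec 1 k'
  else [::].

Definition index_ab (k : seq nat) : seq (nat * nat) := index_ab_rec 1 k.

Definition dual_index (k : seq nat) : seq nat :=
  ab_index [seq (p.2, p.1) | p <- rev (index_ab k)].

Section Pairs.
Variable R : realType.
Implicit Types (k l : seq nat) (z : seq R[i]).

(* [ns] is the family (n_{j,i}), its j-th row being (n_{j,1}, .., n_{j,k_j}). *)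
Definition I_range (ns : seq (seq nat)) : bool :=
  [&& all (all (leq 1)) ns, all (sorted leq) ns &
      sorted (fun r1 r2 => last 0 r1 < head 0 r2)%N ns].

Definition I_term (N : nat) (ns : seq (seq nat)) z : R[i] :=
  \prod_(j < size ns)
    let r := nth [::] ns j in
    (((head 0%N r)%:R - N%:R * z`_j) * \prod_(m <- behead r) m%:R)^-1.

Definition I_sum k z (N : nat) : R[i] :=
  \sum_(n : (wt k).-tuple 'I_N | I_range (reshape k (map val n)))
    I_term N (reshape k (map val n)) z.

Definition in_B (x : R[i]) : bool :=
  ((1 <= `|x|) && (1 <= `|1 - x|)) || (x == 1).

Definition dual_condition k z : Prop :=
  [/\ k <> [::], is_index k, size z = size k, all in_B z &
      ~~ admissible k -> last 0 z != 1].

(* One group (l_j, {1}^{a_j-1}, b_j) over ({1}^{r_j}, {1}^{a_j-1}, w_j). *)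
Record block := Block {
  blk_l : seq nat; blk_a : nat; blk_b : nat; blk_w : R[i] }.

Definition valid_block (x : block) : bool :=
  [&& admissible (blk_l x), (0 < blk_a x)%N, (0 < blk_b x)%N & blk_w x != 1].

Definition blocks_k (s : seq block) l : seq nat :=
  flatten [seq blk_l x ++ rcons (nseq (blk_a x).-1 1%N) (blk_b x) | x <- s]
  ++ l.

Definition blocks_z (s : seq block) l : seq R[i] :=
  flatten [seq nseq (size (blk_l x)) 1
               ++ rcons (nseq (blk_a x).-1 1) (blk_w x) | x <- s]
  ++ nseq (size l) 1.

Definition dual_blocks_k (s : seq block) l : seq nat :=
  dual_index l ++
  flatten [seq rcons (nseq (blk_b x).-1 1%N) (blk_a x) ++ dual_index (blk_l x)
          | x <- rev s].

Definition dual_blocks_z (s : seq block) l : seq R[i] :=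
  nseq (size (dual_index l)) 1 ++
  flatten [seq rcons (nseq (blk_b x).-1 1) (1 - blk_w x)
               ++ nseq (size (dual_index (blk_l x))) 1 | x <- rev s].

Definition decomposition k z (s : seq block) l : Prop :=
  [/\ all valid_block s, admissible l, k = blocks_k s l & z = blocks_z s l].

(* See [dual_pair_exists_unique] for existence and uniqueness. *)
Definition dual_pair k z (k' : seq nat) (z' : seq R[i]) : Prop :=
  exists s l, [/\ decomposition k z s l,
    k' = dual_blocks_k s l & z' = dual_blocks_z s l].

End Pairs.

Lemma index_ab_rec_nseq a m k :
  index_ab_rec a (nseq m 1%N ++ k) = index_ab_rec (a + m) k.
Proof. by elim: m a => [|m IH] a /=; rewrite ?addn0 // IH addSnnS. Qed.

Lemma ab_indexK s : all pos_pair s -> index_ab (ab_index s) = s.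
Proof.
rewrite /index_ab; elim: s => [//|[a b] s IH] /= /andP[/andP[/= a0 b0] ps].
rewrite /ab_index /= -cats1 -catA index_ab_rec_nseq /= eqSS (gtn_eqF b0).
by rewrite IH // add1n prednK.
Qed.

Lemma index_abK k :
  admissible k -> all pos_pair (index_ab k) /\ ab_index (index_ab k) = k.
Proof.
rewrite /index_ab => /andP[ik lk].
suff: forall a, (0 < a)%N -> (a == 1%N) || (k != [::]) ->
    all pos_pair (index_ab_rec a k) /\
    ab_index (index_ab_rec a k) = nseq a.-1 1%N ++ k by apply.
elim: k ik lk => [|x k IH] /= ik lk a a0 ak.
  by move: ak; rewrite orbF => /eqP->.
case/andP: ik => x0 ik.
have lk2 : (2 <= last 2 k)%N by case: (k) lk.
case: eqP => [x1|/eqP x1].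
  have kn : k != [::] by apply: contraTneq lk => ->; rewrite x1.
  have [//||-> ->] := IH ik lk2 a.+1; first by rewrite kn orbT.
  split=> //; rewrite x1 /=; case: a a0 {ak} => // a _.
  by rewrite -[in LHS]addn1 nseqD -catA.
have [//|//|p1 p2] := IH ik lk2 1%N.
rewrite /= /pos_pair /= a0 p1 /ab_index /= -/(ab_index _) p2 /=.
have x2 : (0 < x.-1)%N by case: x x0 x1 {lk} => [|[|x]].
by rewrite x2 -cats1 -catA prednK.
Qed.

Section PairLemmas.
Variable R : realType.
Implicit Types (k l : seq nat) (z : seq R[i]) (s : seq (block R)).

Lemma cat_nseq_uniq (p q : nat) (v w : R[i]) z z' : v != 1 -> w != 1 ->
  nseq p 1 ++ v :: z = nseq q 1 ++ w :: z' -> [/\ p = q, v = w & z = z'].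
Proof.
move=> v1 w1; elim: p q => [|p IH] [|q] /= [].
- by move=> -> ->.
- by move=> e; rewrite e eqxx in v1.
- by move=> e; rewrite -e eqxx in w1.
- by move=> /IH[-> -> ->].
Qed.

Lemma admissible_cat_nseq (p q : nat) l l' : admissible l -> admissible l' ->
  l ++ nseq p 1%N = l' ++ nseq q 1%N -> p = q /\ l = l'.
Proof.
elim: p q => [|p IH] [|q] al al'.
- by rewrite !cats0.
- rewrite cats0 => e; move: al; rewrite e /admissible last_cat /=.
  by rewrite (_ : last _ _ = 1%N) ?andbF //; elim: (q).
- rewrite cats0 => e; move: al'; rewrite -e /admissible last_cat /=.
  by rewrite (_ : last _ _ = 1%N) ?andbF //; elim: (p).
- rewrite -[p.+1]addn1 -[q.+1]addn1 !nseqD !catA !cats1 => /rcons_inj[].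
  by case/(IH _ al al') => -> ->.
Qed.

Lemma decomposition_unique k z s l s' l' :
  decomposition k z s l -> decomposition k z s' l' -> s = s' /\ l = l'.
Proof.
case=> vs al -> -> [vs' al' ek ez]; elim: s s' vs vs' ek ez => [|x s IH] [|x' s'].
- by rewrite /blocks_k.
- move=> _ /andP[/and4P[_ _ _ w1] _] _.
  rewrite /blocks_z /= => /(congr1 (all (pred1 1))).
  by rewrite all_pred1_nseq !all_cat all_rcons /= (negPf w1) /= andbF.
- move=> /andP[/and4P[_ _ _ w1] _] _ _.
  rewrite /blocks_z /= => /(congr1 (all (pred1 1))).
  by rewrite all_pred1_nseq !all_cat all_rcons /= (negPf w1) /= andbF.
move=> /andP[+ vs] /andP[+ vs'].
case: x x' => [k1 a b w] [k2 a' b' w'] /and4P[/= A1 a0 b0 w1] /and4P[/= A2 a0' b0' w1'].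
rewrite /blocks_k /blocks_z /= -!cats1 -!catA /= => ek.
have nD p q (t : seq R[i]) : nseq p 1 ++ nseq q 1 ++ t = nseq (p + q) 1 ++ t.
  by rewrite catA -nseqD.
rewrite !nD => /(cat_nseq_uniq w1 w1')[es ew ez].
have sz : size (k1 ++ nseq a.-1 1%N) = size (k2 ++ nseq a'.-1 1%N).
  by rewrite !size_cat !size_nseq.
move: ek; rewrite [LHS]catA [RHS]catA => /eqP.
rewrite eqseq_cat // => /andP[/eqP /(admissible_cat_nseq A1 A2)[ea ekk]].
move=> /eqP[eb ek]; have [-> ->] := IH s' vs vs' ek ez.
have -> : a = a' by rewrite -(prednK a0) ea prednK.
by rewrite ekk eb ew.
Qed.

Lemma split_ones k : is_index k ->
  exists l m, admissible l /\ k = l ++ nseq m 1%N.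
Proof.
elim/last_ind: k => [|k x IH]; first by exists [::], 0%N.
rewrite /is_index all_rcons => /andP[x0 ik].
case: (ltnP 1 x) => x1.
  exists (rcons k x), 0%N; rewrite cats0 /admissible /is_index last_rcons.
  by rewrite all_rcons x0 ik x1.
have -> : x = 1%N by apply/eqP; rewrite eqn_leq x1 x0.
have [l [m [al ->]]] := IH ik; exists l, m.+1; split=> //.
by rewrite -[m.+1]addn1 nseqD catA cats1.
Qed.

Lemma decomposition_exists k z :
  dual_condition k z -> exists s l, decomposition k z s l.
Proof.
case=> _ ik + _; have [n] := ubnP (size k).
elim: n k z ik => // n IH k z ik kn szk lz.
case: (boolP (all (pred1 1) z)) => [z1|nz1].
  have ez : z = nseq (size k) 1 by rewrite -szk; apply/all_pred1P.
  exists [::], k; split=> //; apply: contraT => na; have := lz na.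
  rewrite ez; case: (k) na => [//|x k' _].
  by rewrite /= (_ : last _ _ = 1) ?eqxx //; elim: (size k').
set p := find (predC (pred1 1)) z.
have hz : has (predC (pred1 1)) z by rewrite has_predC.
have pz : (p < size z)%N by rewrite -has_find.
have ez : z = nseq p 1 ++ z`_p :: drop p.+1 z.
  rewrite -{1}(cat_take_drop p z) (drop_nth 0) //; congr (_ ++ _).
  have {2}-> : p = size (take p z) by rewrite size_takel // ltnW.
  apply/all_pred1P/(all_nthP 0) => i; rewrite size_takel ?(ltnW pz) // => ip.
  by rewrite nth_take //; have /negbFE := before_find 0 ip.
have ek : k = take p k ++ nth 0%N k p :: drop p.+1 k.
  by rewrite -drop_nth -?szk // cat_take_drop.
have := ik; rewrite {1}ek /is_index all_cat /= => /and3P[i1 b0 i2].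
have [l [m [al el]]] := split_ones i1.
have [|||s [l' [vs al' ek' ez']]] := IH (drop p.+1 k) (drop p.+1 z) i2.
- rewrite size_drop; move: kn pz; rewrite szk ltnS => kn pz.
  by apply: leq_trans kn; rewrite ltn_subrL /= (leq_ltn_trans _ pz).
- by rewrite !size_drop szk.
- move=> na; have nk : drop p.+1 k != [::] by apply: contraNneq na => ->.
  have nzd : drop p.+1 z != [::].
    by rewrite -size_eq0 size_drop szk -size_drop size_eq0.
  have : ~~ admissible k.
    apply: contraNN na => /andP[_]; rewrite {1}ek last_cat /= /admissible /is_index i2 /=.
    by case: (drop p.+1 k) nk.
  by move/lz; rewrite {1}ez last_cat /=; case: (drop p.+1 z) nzd.
exists (Block l m.+1 (nth 0%N k p) z`_p :: s), l'; split=> //=.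
- rewrite vs /valid_block /= al b0 andbT /=.
  by have := nth_find 0 hz.
- by rewrite {1}ek el ek' /blocks_k /= -cats1 -!catA.
have sp : p = (size l + m)%N.
  by rewrite -[m in RHS](size_nseq m 1%N) -size_cat -el size_takel // ltnW // -szk.
by rewrite {1}ez {1}sp nseqD ez' /blocks_z /= -cats1 -!catA.
Qed.

Lemma dual_pair_exists_unique k z : dual_condition k z ->
  exists! kz' : seq nat * seq R[i], dual_pair k z kz'.1 kz'.2.
Proof.
move=> /decomposition_exists[s [l dkz]].
exists (dual_blocks_k s l, dual_blocks_z s l); split; first by exists s, l.
move=> [k' z'] [s' [l' /= [dkz' -> ->]]].
by have [-> ->] := decomposition_unique dkz dkz'.
Qed.

End PairLemmas.

(* Main.v *)
(* Encode a pair as a word whose letters are complex numbers: the letter w at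
   the summation variable n contributes 1/(n - N w), so that the factors 1/n are
   letters 0. The reflection n |-> N - n sends w to 1 - w up to a sign and
   reverses the word, which is exactly the passage to the dual pair, except that
   the constraint between adjacent variables was weak iff the right letter is 0
   and is now weak iff the left letter is 1. So the two sums differ only by terms
   in which two adjacent variables coincide at letters (1, u) with u != 0, or
   (u, 0) with u != 1. Letters in B other than 1 are bounded by 1/n, 1/(N - n)
   and 2/N; together with the fact that the word neither starts with 0 nor ends
   with 1, this bounds the colliding terms by O(H_N^wt / N). *)
Require Import Defs.
From HB Require Import structures.
From mathcomp Require Import all_boot all_order all_algebra.
From mathcomp Require Import complex.
From mathcomp Require Import all_classical all_reals all_analysis.
From mathcomp Require Import ring zify.

Import Order.TTheory GRing.Theory Num.Theory.
Import numFieldNormedType.Exports.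

Local Open Scope ring_scope.
Local Open Scope complex_scope.

Set Implicit Arguments.
Unset Strict Implicit.
Unset Printing Implicit Defensive.

(** * Index sums as sums over words *)

Section Words.
Variable R : realType.
Implicit Types (k n : seq nat) (z W : seq R[i]).

Definition word k z : seq R[i] :=
  flatten [seq a.2 :: nseq a.1.-1 0 | a <- zip k z].

(** A letter 0 continues the row of the variable before it, where the inequality is weak; any other
    letter opens a new row, which must lie strictly above the previous one. *)
Definition step (p q : R[i] * nat) : bool :=
  if q.1 == 0 then (p.2 <= q.2)%N else (p.2 < q.2)%N.

(* [step] transported by the reflection (w, n) |-> (1 - w, N - n). *)
Definition dual_step (p q : R[i] * nat) : bool :=
  if p.1 == 1 then (p.2 <= q.2)%N else (p.2 < q.2)%N.

Definition word_term (N : nat) W n : R[i] :=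
  \prod_(p <- zip W n) (p.2%:R - N%:R * p.1)^-1.

(** The length [m] is kept apart from [size W], so that the sums of a pair and of its dual range
    over one type of tuples. *)
Definition word_sum (e : rel (R[i] * nat)) m W (N : nat) : R[i] :=
  \sum_(t : m.-tuple 'I_N |
      all (leq 1) (map val t) && sorted e (zip W (map val t)))
    word_term N W (map val t).

Lemma word_cat k1 k2 z1 z2 : size k1 = size z1 ->
  word (k1 ++ k2) (z1 ++ z2) = word k1 z1 ++ word k2 z2.
Proof. by move=> e; rewrite /word zip_cat // map_cat flatten_cat. Qed.

Lemma size_word k z : is_index k -> size z = size k -> size (word k z) = wt k.
Proof.
elim: k z => [|a k IH] [|x z] //= /andP[a0 ik] [sz].
by rewrite /word /= size_cat size_nseq -/(word k z) IH // -addSn prednK.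
Qed.

Lemma sorted_step_zeros x (m : nat) (r n : seq nat) W :
  sorted step (zip (x :: nseq (size r) 0 ++ W) (m :: r ++ n)) =
  path leq m r && path step (x, last m r) (zip W n).
Proof.
rewrite /=; elim: r m x => [|m' r IH] m x //=.
rewrite {1}/step /= eqxx -andbA; congr (_ && _).
by rewrite -(IH m' x) /=; case: (zip _ _).
Qed.

Lemma I_range_cons r (ns : seq (seq nat)) :
  I_range (r :: ns) =
  [&& all (leq 1) r, sorted leq r,
      (if ns is r' :: _ then last 0 r < head 0 r' else true)%N & I_range ns].
Proof.
rewrite /I_range /=; case: ns => [|r' ns] /=; first by rewrite !andbT.
by case: (all _ r); case: (sorted _ r); case: (_ < _)%N; rewrite /= ?andbF.
Qed.

(** Rows begin exactly at the nonzero letters because no entry of [z] is 0. The induction splits off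
    the first [a] variables, which form the first row. *)
Lemma I_range_word k z n : is_index k -> size z = size k -> 0 \notin z ->
  size n = wt k ->
  I_range (reshape k n) = all (leq 1) n && sorted step (zip (word k z) n).
Proof.
elim: k z n => [|a k IH] [|x z] n //=; first by move=> _ _ _ /size0nil ->.
case/andP=> a0 ik [sz]; rewrite inE negb_or => /andP[x0 z0] sn.
rewrite I_range_cons.
have sd : size (drop a n) = wt k by rewrite size_drop sn /= addKn.
rewrite (IH z) // /word /= -/(word k z).
have st : size (take a n) = a by rewrite size_takel // sn leq_addr.
rewrite [in RHS](_ : n = take a n ++ drop a n);
  last by rewrite cat_take_drop.
move: (take a n) (drop a n) st sd => r n' sr sn'.
case: r sr => [|m r] sr; first by rewrite -sr in a0.
have -> : a.-1 = size r by rewrite -sr.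
rewrite cat_cons sorted_step_zeros -cat_cons all_cat /=.
case: k ik sz sn' {IH sn a0} => [|b k] /=.
  by move=> _; case: z {z0} => // _ /size0nil ->; rewrite /= !andbT.
case/andP=> b0 ik; case: z z0 => [//|y z]; rewrite inE negb_or => /andP[y0 _] _.
case: n' => [|m' n'] sn'; first by rewrite -(prednK b0) in sn'.
rewrite /word /= -/(word k z) /= [in RHS]/step /= eq_sym (negPf y0) -(prednK b0) /=.
case: (0 < m)%N; case: (all _ r); case: (path _ _ _); case: (_ < m')%N => //=;
  by rewrite ?andbF.
Qed.

Lemma I_term_word N k z n : is_index k -> size z = size k -> size n = wt k ->
  I_term N (reshape k n) z = word_term N (word k z) n.
Proof.
rewrite /I_term /word_term.
elim: k z n => [|a k IH] [|x z] n //=.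
  by move=> _ _ _; rewrite big_ord0 /word /=; case: n => *; rewrite big_nil.
case/andP=> a0 ik [sz] sn; rewrite big_ord_recl /=.
have sd : size (drop a n) = wt k by rewrite size_drop sn /= addKn.
rewrite (IH z) // /word /= -/(word k z).
have st : size (take a n) = a by rewrite size_takel // sn leq_addr.
rewrite [in RHS](_ : n = take a n ++ drop a n);
  last by rewrite cat_take_drop.
move: (take a n) (drop a n) st sd => r n' sr sn'.
case: r sr => [|m r] sr; first by rewrite -sr in a0.
have -> : a.-1 = size r by rewrite -sr.
rewrite /= big_cons /= zip_cat ?size_nseq // big_cat /= mulrA.
congr (_ * _); rewrite invfM; congr (_ * _); rewrite -prodfV.
elim: r {sr} => [|y r IHr] /=; first by rewrite !big_nil.
by rewrite !big_cons IHr /= mulr0 subr0.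
Qed.

Lemma I_sum_word k z m N : is_index k -> size z = size k -> 0 \notin z ->
  wt k = m -> I_sum k z N = word_sum step m (word k z) N.
Proof.
move=> ik sz z0 <-; rewrite /I_sum /word_sum.
have sv (t : (wt k).-tuple 'I_N) : size (map val t) = wt k.
  by rewrite size_map size_tuple.
apply: eq_big => [t|t _]; first exact: I_range_word.
exact: I_term_word.
Qed.

(** * Reflection of words and the dual pair *)

Definition dual_word W : seq R[i] := rev [seq 1 - w | w <- W].

(** With M = N + 1, the substitution n -> M - n in reverse order is a bijection of the tuples, and
    (M - n) - M (1 - w) = -(n - M w) gives one sign per letter. *)
Lemma word_sum_dual m W N : size W = m ->
  word_sum step m (dual_word W) N.+1 =
  (-1) ^+ m * word_sum dual_step m W N.+1.
Proof.
move=> sW.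
(* Negation modulo N + 1 is the reflection on positive values and fixes 0, so it is an involution of
   the whole type and preserves positivity. *)
have [opp [oppK val_opp pos_opp]] : exists opp : 'I_N.+1 -> 'I_N.+1,
    [/\ involutive opp,
        forall x : 'I_N.+1, (0 < x)%N -> opp x = (N.+1 - x)%N :> nat &
        forall x : 'I_N.+1, (0 < opp x)%N = (0 < x)%N].
  have val_opp (x : 'I_N.+1) : (0 < x)%N -> (- x : 'I_N.+1) = (N.+1 - x)%N :> nat.
    by case: x => -[//|x] hx _ /=; rewrite modn_small // subSS ltnS leq_subr.
  exists (fun x : 'I_N.+1 => - x); split=> [|//|x]; first exact: opprK.
  have [x0|x0] := posnP x; last by rewrite val_opp // subn_gt0 ltn_ord.
  by rewrite /= x0 subn0 modnn.
pose opp_rev (t : m.-tuple 'I_N.+1) := [tuple of rev (map opp t)].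
have opp_revK : involutive opp_rev.
  move=> t; apply: val_inj; rewrite /= map_rev revK -map_comp.
  by rewrite -[RHS]map_id; apply: eq_map => x /=; rewrite oppK.
rewrite /word_sum (reindex_inj (inv_inj opp_revK)) mulr_sumr /=.
have szt (t : m.-tuple 'I_N.+1) : size W = size t by rewrite size_tuple.
have zipE (t : m.-tuple 'I_N.+1) :
    zip (dual_word W) (map val (rev (map opp t))) =
    rev [seq (1 - a.1, val (opp a.2)) | a <- zip W t].
  rewrite /dual_word map_rev -rev_zip ?size_map // -map_comp; congr rev.
  by elim: W (val t) {szt sW} => [|w W IH] [|x s] //=; rewrite IH.
have zipW (t : m.-tuple 'I_N.+1) :
    zip W (map val t) = [seq (a.1, val a.2) | a <- zip W t].
  by elim: W (val t) {zipE szt sW} => [|w W IH] [|x s] //=; rewrite IH.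
have allE (t : m.-tuple 'I_N.+1) :
    all (leq 1) (map val (rev (map opp t))) = all (leq 1) (map val t).
  by rewrite map_rev all_rev -map_comp !all_map; apply: eq_all => x; apply: pos_opp.
have posP (t : m.-tuple 'I_N.+1) : all (leq 1) (map val t) ->
    forall a, a \in zip W t -> (0 < a.2)%N.
  move=> /allP h [w x] /= wx; apply: h; apply: map_f.
  by move: wx => /(map_f snd); rewrite -/(unzip2 _) unzip2_zip // (szt t).
apply: eq_big => [t|t /andP[+ _]]; rewrite allE.
  case: (boolP (all _ _)) => //= /posP pos_t.
  rewrite zipE zipW rev_sorted !sorted_map.
  apply: (eq_in_sorted _ (allss (zip W t))) => a b /pos_t a0 /pos_t b0.
  (* 1 - w is 0 exactly when w is 1, and reversal has made the left letter of a pair the right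
     one. *)
  rewrite /step /dual_step /= !val_opp // subr_eq0 eq_sym.
  by rewrite leq_sub2lE ?(ltnW (ltn_ord _)) // ltn_sub2lE // ltnW.
move=> /posP pos_t; rewrite /word_term zipE zipW big_rev !big_map.
have -> : (-1) ^+ m = \prod_(a <- zip W t) (-1) :> R[i].
  by rewrite big_const_seq count_predT iter_mulr_1 size_zip sW size_tuple minnn.
rewrite -big_split /= big_seq [RHS]big_seq; apply: eq_bigr => a /pos_t a0.
rewrite val_opp // natrB ?(ltnW (ltn_ord _)) // mulrBr mulr1 opprB.
by rewrite mulN1r -invrN opprB [in LHS]addrC addrA subrK.
Qed.
Lemma dual_word_cat W1 W2 :
  dual_word (W1 ++ W2) = dual_word W2 ++ dual_word W1.
Proof. by rewrite /dual_word map_cat rev_cat. Qed.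

Lemma word_hook a b w :
  word (rcons (nseq a 1%N) b) (rcons (nseq a 1) w) =
  nseq a 1 ++ w :: nseq b.-1 0.
Proof.
by elim: a => [|a IH]; [rewrite /word /= cats0 | rewrite /word /= -/(word _ _) IH].
Qed.

(** The runs of 1 and of 0 around w trade places: this is the exchange of a_j and b_j in the dual
    pair. *)
Lemma dual_word_hook a b w :
  dual_word (nseq a 1 ++ w :: nseq b 0) = nseq b 1 ++ (1 - w) :: nseq a 0.
Proof.
rewrite -cat1s !dual_word_cat /dual_word !map_nseq subrr subr0 !rev_nseq.
by rewrite -catA.
Qed.

Lemma ab_index_cat s1 s2 : ab_index (s1 ++ s2) = ab_index s1 ++ ab_index s2.
Proof. by rewrite /ab_index map_cat flatten_cat. Qed.

(** Over the letter 1, the group ({1}^{a-1}, b+1) spells 1^a 0^b, and reflection turns it into 1^b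
    0^a, the word of the dual group. *)
Lemma word_dual_ab s : all pos_pair s ->
  let s' := [seq (p.2, p.1) | p <- rev s] in
  word (ab_index s') (nseq (size (ab_index s')) 1) =
  dual_word (word (ab_index s) (nseq (size (ab_index s)) 1)).
Proof.
elim: s => [|[a b] s IH] //= /andP[/andP[/= a0 b0] /IH /= {}IH].
rewrite rev_cons map_rcons -cats1 ab_index_cat !size_cat !nseqD.
rewrite !word_cat ?size_nseq // dual_word_cat IH; congr (_ ++ _).
have h c d : word (rcons (nseq c 1%N) d) (nseq (size (rcons (nseq c 1%N) d)) 1)
    = nseq c 1 ++ 1 :: nseq d.-1 0.
  by rewrite -word_hook size_rcons size_nseq -[c.+1]addn1 nseqD cats1.
rewrite /ab_index /= cats0 !h dual_word_hook subrr.
(* The middle letter is 1 on one side and 1 - 1 = 0 on the other; each is absorbed into the adjacent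
   run of its own kind. *)
have nS (x : R[i]) c W : (0 < c)%N -> nseq c.-1 x ++ x :: W = nseq c x ++ W.
  by case: c => // c _; rewrite -[in RHS]addn1 nseqD -catA.
by rewrite nS //; case: a a0.
Qed.

Lemma word_dual_index l : admissible l ->
  word (dual_index l) (nseq (size (dual_index l)) 1) =
  dual_word (word l (nseq (size l) 1)).
Proof. by move=> /index_abK[/word_dual_ab /= + e]; rewrite e. Qed.

Lemma size_dual_blocks (s : seq (block R)) l :
  size (dual_blocks_k s l) = size (dual_blocks_z s l).
Proof.
rewrite /dual_blocks_k /dual_blocks_z !size_cat size_nseq; congr (_ + _)%N.
rewrite !size_flatten /shape -!map_comp; congr sumn; apply: eq_map => x /=.
by rewrite !size_cat !size_rcons !size_nseq.
Qed.

(** Reflection reverses concatenations, so it is enough to reflect the admissible parts and the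
    groups around each w_j separately. *)
Lemma word_dual_blocks (s : seq (block R)) l : all (@valid_block R) s ->
  admissible l ->
  word (dual_blocks_k s l) (dual_blocks_z s l) =
  dual_word (word (blocks_k s l) (blocks_z s l)).
Proof.
move=> + al; elim: s => [|[k a b w] s IH] /=.
  by move=> _; rewrite /dual_blocks_k /dual_blocks_z /= !cats0 word_dual_index.
case/andP=> /and4P[/= ak a0 b0 _] /IH; clear IH.
set y := Block k a b w => IH.
have sb c d x : size (rcons (nseq c 1%N) d) = size (rcons (nseq c (1 : R[i])) x).
  by rewrite !size_rcons !size_nseq.
have -> : dual_blocks_k (y :: s) l =
    dual_blocks_k s l ++ rcons (nseq b.-1 1%N) a ++ dual_index k.
  by rewrite /dual_blocks_k rev_cons map_rcons flatten_rcons catA.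
have -> : dual_blocks_z (y :: s) l =
    dual_blocks_z s l ++ rcons (nseq b.-1 1) (1 - w)
      ++ nseq (size (dual_index k)) 1.
  by rewrite /dual_blocks_z rev_cons map_rcons flatten_rcons catA.
have -> : blocks_k (y :: s) l = (k ++ rcons (nseq a.-1 1%N) b) ++ blocks_k s l.
  by rewrite /blocks_k /= -!catA.
have -> : blocks_z (y :: s) l =
    (nseq (size k) 1 ++ rcons (nseq a.-1 1) w) ++ blocks_z s l.
  by rewrite /blocks_z /= -!catA.
have sd := size_dual_blocks s l.
move: (dual_blocks_k s l) (dual_blocks_z s l) (blocks_k s l) (blocks_z s l) IH sd.
move=> K Z K' Z' IH sd.
rewrite word_cat // word_cat ?sb // word_cat; last first.
  by rewrite !size_cat size_nseq (sb _ _ w).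
rewrite word_cat ?size_nseq //.
by rewrite !dual_word_cat IH !word_hook dual_word_hook word_dual_index.
Qed.

(** Adjoining 0 to B accounts for the zeros inside rows and makes the set stable under w -> 1 -
    w. *)
Definition letter (w : R[i]) : bool := (w == 0) || in_B w.

Lemma word_letters k z : all (@in_B R) z ->
  all letter (word k z).
Proof.
elim: k z => [|a k IH] [|x z] //= /andP[Bx Bz].
by rewrite /letter Bx orbT all_cat all_nseq /letter eqxx orbT /= IH.
Qed.

Lemma in_B0 : in_B (0 : R[i]) = false.
Proof. by rewrite /in_B normr0 ler10 eq_sym oner_eq0. Qed.

Lemma word_head k z : k != [::] -> size z = size k -> all (@in_B R) z ->
  head 0 (word k z) != 0.
Proof.
case: k z => [|a k] [|x z] //= _ _ /andP[Bx _].
by apply: contraTneq Bx => ->; rewrite in_B0.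
Qed.

(** If the last entry of [k] is at least 2, the word ends with 0. Otherwise it ends with the last
    entry of [z], and [k] is not admissible, so the dual condition applies. *)
Lemma word_last k z : dual_condition k z -> last 0 (word k z) != 1.
Proof.
case=> /eqP k0 ik sz _ lz.
case/lastP: k k0 ik sz lz => // k a _.
case/lastP: z => [|z x]; rewrite ?size_rcons // => ik [sz] lz.
rewrite -!cats1 word_cat // last_cat /word /= cats0.
have [a1|a1] := leqP a 1.
  have -> : a.-1 = 0%N by case: a a1 {ik lz} => [|[]].
  by move: lz; rewrite /admissible !last_rcons ltnNge a1 andbF => /(_ isT).
rewrite -(prednK (_ : (0 < a.-1)%N)); last by case: a a1 {ik lz} => [|[]].
by rewrite -addn1 nseqD /= last_cat /= eq_sym oner_eq0.
Qed.
End Words.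

Arguments step {R} p q.
Arguments dual_step {R} p q.
Arguments letter {R} w.

(** * Harmonic sums *)

Section HarmonicSums.
Variable C : numFieldType.

Definition harmonic_sum (N : nat) : C := \sum_(1 <= x < N) x%:R^-1.

Lemma harmonic_sum_rev N : \sum_(1 <= x < N) (N - x)%:R^-1 = harmonic_sum N.
Proof.
rewrite [LHS]big_nat_rev /=; apply: eq_big_nat => x /andP[x0 xN].
by rewrite add1n subSS subKn // ltnW.
Qed.

Lemma harmonic_sum_ge1 N : (1 < N)%N -> 1 <= harmonic_sum N.
Proof.
move=> N1; rewrite /harmonic_sum big_ltn // invr1 lerDl.
by apply: sumr_ge0 => x _; rewrite invr_ge0 ler0n.
Qed.

(** Partial fractions: 1/(n (N - n)) = (1/n + 1/(N - n))/N. *)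
Lemma harmonic_sum_pairs N : (0 < N)%N ->
  \sum_(1 <= n < N) (n%:R^-1 * (N - n)%:R^-1) = 2 / N%:R * harmonic_sum N.
Proof.
move=> N0; rewrite mulrAC -[2]/(1 + 1) mulrDl mul1r -{2}harmonic_sum_rev.
rewrite -big_split mulr_suml; apply: eq_big_nat => n /andP[n0 nN] /=.
have n_neq0 : n%:R != 0 :> C by rewrite pnatr_eq0 -lt0n.
have Nn_neq0 : (N - n)%:R != 0 :> C by rewrite pnatr_eq0 -lt0n subn_gt0.
have N_neq0 : N%:R != 0 :> C by rewrite pnatr_eq0 -lt0n.
by rewrite natrB ?(ltnW nN) // in Nn_neq0 *; field; apply/and3P.
Qed.

(** Each of the N - n terms is at most 1/n. The factor N - n will cancel one of two factors 1/(N -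
    n) at a collision; [head_sum_le] is the mirror image. *)
Lemma tail_sum_le n N : (0 < n)%N -> (n <= N)%N ->
  \sum_(1 <= x < N | (n <= x)%N) x%:R^-1 <= (N - n)%:R * n%:R^-1 :> C.
Proof.
move=> n0 nN; rewrite -(big_nat_widenl n 1 N predT) // mulr_natl -sumr_const_nat.
apply: ler_sum_nat => x /andP[nx _].
by rewrite lef_pV2 ?ler_nat // posrE ltr0n // (leq_trans n0).
Qed.

Lemma head_sum_le n N : (n < N)%N ->
  \sum_(1 <= x < N | (x <= n)%N) (N - x)%:R^-1 <= n%:R * (N - n)%:R^-1 :> C.
Proof.
move=> nN; rewrite -(big_nat_widen 1 n.+1 N predT) // mulr_natl.
rewrite -[X in _ *+ X](subn1 n.+1) -sumr_const_nat.
apply: ler_sum_nat => x /andP[_ xn].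
have xN : (x < N)%N := leq_ltn_trans (xn : (x <= n)%N) nN.
by rewrite lef_pV2 ?ler_nat ?leq_sub2l // posrE ltr0n subn_gt0.
Qed.
End HarmonicSums.

(** * Bounds for sums of products over tuples *)

(** Tuples are grouped by their value n at position [i]. For fixed n the conditions on the
    coordinates become independent, and the sum of products factors. *)
Lemma sum_prod_le (C : numDomainType) (m N : nat) (i : 'I_m)
    (g : 'I_m -> 'I_N -> C) (Q : pred (m.-tuple 'I_N))
    (P : 'I_N -> 'I_m -> pred 'I_N) (A : pred 'I_N) :
  (forall l x, 0 <= g l x) ->
  (forall t, Q t -> A (tnth t i) && [forall l, P (tnth t i) l (tnth t l)]) ->
  \sum_(t | Q t) \prod_l g l (tnth t l) <=
  \sum_(n | A n) \prod_l \sum_(x | P n l x) g l x.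
Proof.
move=> g0 QP; rewrite (partition_big (fun t => tnth t i) A); last first.
  by move=> t /QP /andP[].
apply: ler_sum => n _; rewrite bigA_distr_big_dep.
(* Distributivity produces a sum over finite functions, so tuples are identified with them. *)
pose toff (t : m.-tuple 'I_N) : {ffun 'I_m -> 'I_N} := [ffun l => tnth t l].
have toffK : cancel toff (fun f : {ffun 'I_m -> 'I_N} => [tuple f l | l < m]).
  by move=> t; apply: eq_from_tnth => l; rewrite tnth_mktuple ffunE.
have fftK : cancel (fun f : {ffun 'I_m -> 'I_N} => [tuple f l | l < m]) toff.
  by move=> f; apply/ffunP => l; rewrite ffunE tnth_mktuple.
rewrite (reindex toff); last exact/onW_bij/(Bijective toffK fftK).
rewrite big_mkcond [leRHS]big_mkcond; apply: ler_sum => t _.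
have pg : 0 <= \prod_l g l (tnth t l) by apply: prodr_ge0.
under [in leRHS]eq_bigr => l _ do rewrite ffunE.
case: ifP => [/andP[/QP /andP[_ /forallP h] /eqP en]|_]; last by case: ifP.
rewrite ifT //; apply/familyP => l; rewrite ffunE -en; exact: h.
Qed.

(** At most m - 1 positions lie outside the nonempty set [S], and 1 <= [H] allows raising the
    exponent to m - 1. *)
Lemma prod_le_sub (C : numDomainType) (m : nat) (S : {set 'I_m}) (i : 'I_m)
    (G : 'I_m -> C) (H : C) :
  1 <= H -> i \in S -> (forall l, 0 <= G l <= H) ->
  \prod_l G l <= \prod_(l in S) G l * H ^+ m.-1.
Proof.
move=> H1 iS GH; rewrite (bigID (mem S)) /=; apply: ler_wpM2l.
  by apply: prodr_ge0 => l _; case/andP: (GH l).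
apply: (@le_trans _ _ (\prod_(l in ~: S) H)).
  rewrite [leLHS](eq_bigl (fun l => l \in ~: S)) => [|l]; last by rewrite inE.
  by apply: ler_prod => l _; apply: GH.
have S0 : (0 < #|S|)%N by apply/card_gt0P; exists i.
rewrite prodr_const ler_weXn2l //.
apply: (@leq_trans (#|S| + #|~: S|).-1); last by rewrite cardsC card_ord.
by case: #|S| S0 => // c _; apply: leq_addl.
Qed.

(** * Size of a single letter *)

Section Letters.
Variable R : realType.
Local Notation C := R[i].
Implicit Types (w : C) (x N : nat) (W : seq C).

Definition letter_abs N w x : C := `|(x%:R - N%:R * w)^-1|.

Lemma letter_abs_ge0 N w x : 0 <= letter_abs N w x.
Proof. exact: normr_ge0. Qed.

Lemma letter_absC N w x : (x <= N)%N ->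
  letter_abs N w x = letter_abs N (1 - w) (N - x).
Proof.
move=> xN; rewrite /letter_abs natrB // mulrBr mulr1 -[in RHS]normrN -invrN.
by congr (`|_^-1|); ring.
Qed.

(** For w in B other than 1, write x - N w = N (1 - w) - (N - x); as |1 - w| >= 1, its modulus is at
    least N - (N - x) = x. *)
Lemma letter_abs_le_inv N w x : letter w -> w != 1 -> (0 < x)%N -> (x < N)%N ->
  letter_abs N w x <= x%:R^-1.
Proof.
move=> lw w1 x0 xN; have xC0 : 0 < x%:R :> C by rewrite ltr0n.
rewrite /letter_abs normfV; case/orP: lw => [/eqP->|].
  by rewrite mulr0 subr0 normr_nat.
rewrite /in_B (negPf w1) orbF => /andP[_ h].
have hx : x%:R <= `|x%:R - N%:R * w|.
  have -> : x%:R - N%:R * w = N%:R * (1 - w) - (N - x)%:R.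
    by rewrite natrB ?(ltnW xN) //; ring.
  apply: le_trans (lerB_dist _ _); rewrite normrM !normr_nat lerBrDr.
  by rewrite -natrD subnKC ?(ltnW xN) // ler_peMr.
by rewrite lef_pV2 // posrE // (lt_le_trans xC0 hx).
Qed.

Lemma letter_abs_le_invC N w x : letter w -> w != 0 ->
  (0 < x)%N -> (x < N)%N -> letter_abs N w x <= (N - x)%:R^-1.
Proof.
move=> lw w0 x0 xN; rewrite letter_absC ?(ltnW xN) //.
apply: letter_abs_le_inv; rewrite ?subn_gt0 ?ltn_subrL ?x0 ?(ltn_trans x0) //.
  move: lw; rewrite /letter /in_B (negPf w0) orFb subKr.
  by case/orP => [/andP[-> ->]|/eqP ->]; rewrite ?subrr ?eqxx ?orbT.
by rewrite -[in X in _ != X](subr0 1) (inj_eq (subrI 1)).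
Qed.

(** Both previous bounds hold, and the larger of x and N - x is at least N/2. *)
Lemma letter_abs_le2 N w x : letter w -> w != 0 -> w != 1 ->
  (0 < x)%N -> (x < N)%N -> letter_abs N w x <= 2 / N%:R.
Proof.
move=> lw w0 w1 x0 xN; have N0 := ltn_trans x0 xN.
have h y : (0 < y)%N -> (N <= y * 2)%N -> y%:R^-1 <= 2 / N%:R :> C.
  move=> y0 Ny; rewrite ler_pdivlMr ?ltr0n // mulrC ler_pdivrMr ?ltr0n //.
  by rewrite -natrM ler_nat mulnC.
have [Nx|Nx] := leqP N (x * 2).
  exact: le_trans (letter_abs_le_inv lw w1 x0 xN) (h x x0 Nx).
apply: le_trans (letter_abs_le_invC lw w0 x0 xN) (h _ _ _).
  by rewrite subn_gt0.
by move: Nx; clear; lia.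
Qed.

Lemma letter_abs_sum N w (P : pred nat) : letter w ->
  \sum_(1 <= x < N | P x) letter_abs N w x <= harmonic_sum C N.
Proof.
move=> lw; apply: (@le_trans _ _ (\sum_(1 <= x < N) letter_abs N w x)).
  rewrite [leLHS]big_mkcond; apply: ler_sum => x _; case: ifP => // _.
  exact: letter_abs_ge0.
case: (eqVneq w 1) => [w1|w1].
  rewrite -harmonic_sum_rev; apply: ler_sum_nat => x /andP[x0 xN].
  by apply: letter_abs_le_invC => //; rewrite w1 oner_eq0.
by apply: ler_sum_nat => x /andP[x0 xN]; apply: letter_abs_le_inv.
Qed.
End Letters.

(** * Sums over tuples with two equal adjacent variables *)

Section Collisions.
Variable R : realType.
Local Notation C := R[i].
Local Notation H := (harmonic_sum C).
Implicit Types (W : seq C) (N : nat).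

Lemma word_termE m N W (t : m.-tuple 'I_N) : size W = m ->
  word_term N W (map val t) =
  \prod_(l < m) ((tnth t l)%:R - N%:R * W`_l)^-1.
Proof.
move=> sW; rewrite /word_term (big_nth (0, 0%N)).
rewrite size_zip size_map size_tuple sW minnn big_mkord.
apply: eq_bigr => l _; rewrite nth_zip ?size_map ?size_tuple //=.
by rewrite (nth_map (tnth t l)) ?size_tuple // -tnth_nth.
Qed.

Lemma norm_word_term m N W (t : m.-tuple 'I_N) : size W = m ->
  `|word_term N W (map val t)| = \prod_(l < m) letter_abs N W`_l (tnth t l).
Proof. by move=> sW; rewrite word_termE // normr_prod. Qed.

Section Collision.
Variables (m N : nat) (W : seq C) (i i' : 'I_m).
Hypotheses (sW : size W = m) (lW : all letter W) (N1 : (1 < N)%N).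
Hypotheses (ii' : i' = i.+1 :> nat).

(** What monotonicity leaves of a coordinate when positions [i] and [i'] share the value n: at most
    n before them, at least n after them, and n itself at both. *)
Definition window (n : nat) (l : 'I_m) (x : nat) : bool :=
  ((i <= l) ==> (n <= x))%N && ((l <= i') ==> (x <= n))%N.

Definition window_sum (n : nat) (l : 'I_m) : C :=
  \sum_(1 <= x < N | window n l x) letter_abs N W`_l x.

Lemma letter_nth (l : 'I_m) : letter W`_l.
Proof. by apply: (allP lW); rewrite mem_nth ?sW. Qed.

Lemma window_sum_bounds n l : 0 <= window_sum n l <= H N.
Proof.
rewrite letter_abs_sum ?letter_nth // andbT.
by apply: sumr_ge0 => x _; apply: letter_abs_ge0.
Qed.

Lemma window_sum_eq n (l : 'I_m) : (0 < n < N)%N -> (i <= l <= i')%N ->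
  window_sum n l = letter_abs N W`_l n.
Proof.
move=> n0N /andP[il li']; rewrite /window_sum.
rewrite (eq_bigl (fun x => x == n)) => [|x].
  by rewrite big_nat1_eq n0N.
by rewrite /window il li' /= eqn_leq andbC.
Qed.

Lemma window_pair n (c : C) : (0 < n < N)%N ->
  letter_abs N W`_i n * letter_abs N W`_i' n <= c ->
  \prod_(l in [set i; i']) window_sum n l <= c.
Proof.
move=> n0N; have lei : (i <= i')%N by rewrite ii'.
rewrite big_setU1; last by rewrite inE -val_eqE /= ii' neq_ltn ltnSn.
by rewrite big_set1 !window_sum_eq ?leqnn ?lei.
Qed.

Lemma window_sum_tail n (l : 'I_m) : (0 < n < N)%N -> (i' < l)%N -> W`_l != 1 ->
  window_sum n l <= (N - n)%:R * n%:R^-1.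
Proof.
move=> /andP[n0 nN] il w1; apply: le_trans (tail_sum_le _ n0 (ltnW nN)).
rewrite /window_sum (eq_bigl (fun x => n <= x)%N) => [|x]; last first.
  by rewrite /window (leqNgt l) il andbT (leq_trans _ (ltnW il)) // ii'.
rewrite big_nat_cond [leRHS]big_nat_cond; apply: ler_sum => x.
by case/andP=> /andP[x0 xN] _; apply: letter_abs_le_inv (letter_nth l) w1 x0 xN.
Qed.

Lemma window_sum_head n (l : 'I_m) : (0 < n < N)%N -> (l < i)%N -> W`_l != 0 ->
  window_sum n l <= n%:R * (N - n)%:R^-1.
Proof.
move=> /andP[n0 nN] li w0; apply: le_trans (head_sum_le _ nN).
rewrite /window_sum (eq_bigl (fun x => x <= n)%N) => [|x]; last first.
  by rewrite /window leqNgt li /= (leq_trans (ltnW li)) // ii'.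
rewrite big_nat_cond [leRHS]big_nat_cond; apply: ler_sum => x.
by case/andP=> /andP[x0 xN] _; apply: letter_abs_le_invC (letter_nth l) w0 x0 xN.
Qed.

(** Weak monotonicity follows from either of [step] and [dual_step], so one set of tuples serves
    both sums. *)
Definition colliding (t : m.-tuple 'I_N) : bool :=
  [&& all (leq 1) (map val t), sorted leq (map val t) &
      tnth t i == tnth t i'].

Lemma colliding_sum_window :
  \sum_(t | colliding t) `|word_term N W (map val t)| <=
  \sum_(1 <= n < N) \prod_l window_sum n l.
Proof.
under eq_bigr => t _ do rewrite norm_word_term //.
rewrite big_geq_mkord /=.
under [leRHS]eq_bigr => n _ do
  under eq_bigr => l _ do rewrite /window_sum big_geq_mkord.
apply: (sum_prod_le (i := i) (g := fun l (x : 'I_N) => letter_abs N W`_l x)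
  (P := fun (n : 'I_N) l (x : 'I_N) => window n l x && (0 < x)%N)).
  by move=> l x; apply: letter_abs_ge0.
move=> t /and3P[/allP t0 st /eqP eqt].
have t_gt0 l : (0 < tnth t l)%N by apply/t0/map_f/mem_tnth.
have nthE (l : 'I_m) : nth 0%N (map val t) l = tnth t l.
  by rewrite (nth_map (tnth t l)) ?size_tuple // -tnth_nth.
have mono (l1 l2 : 'I_m) : (l1 <= l2)%N -> (tnth t l1 <= tnth t l2)%N.
  move=> l12; rewrite -!nthE.
  by apply: (sorted_leq_nth leq_trans leqnn) => //;
    rewrite inE size_map size_tuple.
rewrite t_gt0; apply/forallP => l; rewrite t_gt0 andbT /window.
by apply/andP; split; apply/implyP => /mono //; rewrite eqt.
Qed.

(** For fixed n the positions in [S] are bounded together by [c n]; the others cost at most m - 1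
    factors H, and the sum of [c] brings the last H with the decisive 2/N. *)
Lemma colliding_sum_le (S : {set 'I_m}) (c : nat -> C) : i \in S ->
  (forall n, (0 < n < N)%N -> \prod_(l in S) window_sum n l <= c n) ->
  \sum_(1 <= n < N) c n <= 2 / N%:R * H N ->
  \sum_(t | colliding t) `|word_term N W (map val t)| <= 2 / N%:R * H N ^+ m.
Proof.
move=> iS Sc cH; apply: le_trans colliding_sum_window _.
have H1 := harmonic_sum_ge1 C N1; have H0 := le_trans ler01 H1.
have m0 : (0 < m)%N by apply: leq_trans (ltn_ord i).
apply: (@le_trans _ _ (\sum_(1 <= n < N) c n * H N ^+ m.-1)).
  apply: ler_sum_nat => n n0N.
  apply: le_trans (prod_le_sub H1 iS (window_sum_bounds n)) _.
  by rewrite ler_wpM2r ?exprn_ge0 // Sc.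
by rewrite -mulr_suml -[in leRHS](prednK m0) exprS mulrA ler_wpM2r ?exprn_ge0.
Qed.

Lemma colliding_pair_le (c : nat -> C) :
  (forall n, (0 < n < N)%N -> letter_abs N W`_i n * letter_abs N W`_i' n <= c n) ->
  \sum_(1 <= n < N) c n <= 2 / N%:R * H N ->
  \sum_(t | colliding t) `|word_term N W (map val t)| <= 2 / N%:R * H N ^+ m.
Proof.
move=> hc; apply: (colliding_sum_le (S := [set i; i'])); rewrite ?inE ?eqxx //.
by move=> n n0N; apply: window_pair n0N (hc n n0N).
Qed.

(** For letters (1, 1) or (0, 0) the pair gives only v^2 with v = 1/(N - n) or 1/n, whose sum over n
    does not decay. A third position [j] contributes u/v, leaving u v = 1/(n (N - n)). *)
Lemma colliding_triple_le (j : 'I_m) (u v : nat -> C) : j != i -> j != i' ->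
  (forall n, (0 < n < N)%N ->
    letter_abs N W`_i n * letter_abs N W`_i' n <= v n * v n) ->
  (forall n, (0 < n < N)%N -> window_sum n j <= (v n)^-1 * u n) ->
  (forall n, (0 < n < N)%N -> 0 < v n /\ u n * v n = n%:R^-1 * (N - n)%:R^-1) ->
  \sum_(t | colliding t) `|word_term N W (map val t)| <= 2 / N%:R * H N ^+ m.
Proof.
move=> ji ji' hv hj uv.
apply: (colliding_sum_le (S := j |: [set i; i'])
  (c := fun n => n%:R^-1 * (N - n)%:R^-1)).
- by rewrite !inE eqxx orbT.
- move=> n n0N; have [v0 <-] := uv n n0N.
  rewrite big_setU1; last by rewrite !inE negb_or ji.
  have -> : u n * v n = ((v n)^-1 * u n) * (v n * v n).
    by field; rewrite gt_eqF.
  have w0 l : 0 <= window_sum n l by case/andP: (window_sum_bounds n l).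
  by apply: ler_pM; rewrite ?w0 ?prodr_ge0 ?hj // window_pair // hv.
- by rewrite harmonic_sum_pairs ?(ltnW N1).
Qed.

(** The letters are (1, u) with u nonzero or (u, 0) with u not 1. The gain 1/N comes from u when u
    is neither 0 nor 1, and from an end of the word otherwise. *)
Lemma colliding_le : head 0 W != 0 -> last 0 W != 1 ->
  (W`_i == 1) != (W`_i' == 0) ->
  \sum_(t | colliding t) `|word_term N W (map val t)| <= 2 / N%:R * H N ^+ m.
Proof.
move=> hW tW; have N0 : (0 < N)%N := ltnW N1.
have m0 : (0 < m)%N by apply: leq_trans (ltn_ord i).
have inv_gt0 n : (0 < n)%N -> 0 < n%:R^-1 :> C by move=> n0; rewrite invr_gt0 ltr0n.
have ge0 := letter_abs_ge0 N.
have [wi1|wi1] := eqVneq W`_i 1; have [wi'0|wi'0] := eqVneq W`_i' 0 => // _.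
  have wi0 : W`_i != 0 by rewrite wi1 oner_eq0.
  have [wi'1|wi'1] := eqVneq W`_i' 1.
    (* Letters (1, 1): the last letter is not 1, so it stands after [i'], and its variable, being at
       least n, sums to at most (N - n)/n. *)
    have jm : (m.-1 < m)%N by rewrite prednK.
    pose j := Ordinal jm.
    have wj : W`_j != 1 by move: tW; rewrite -nth_last sW.
    apply: (@colliding_triple_le j (fun n => n%:R^-1) (fun n => (N - n)%:R^-1)).
    - by apply: contraNneq wj => ->; rewrite wi1.
    - by apply: contraNneq wj => ->; rewrite wi'1.
    - by move=> n /andP[n0 nN]; apply: ler_pM; rewrite ?ge0 //;
        apply: letter_abs_le_invC (letter_nth _) _ n0 nN.
    - move=> n n0N; rewrite invrK; apply: window_sum_tail => //.
      rewrite ltn_neqAle -ltnS prednK // ltn_ord andbT.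
      by apply: contraNneq wj => ji; rewrite -ji wi'1.
    - by move=> n /andP[n0 nN]; split=> //; apply: inv_gt0; rewrite subn_gt0.
  (* Letters (1, u) with u neither 0 nor 1: u gives 2/N and 1 gives 1/(N - n). *)
  apply: (@colliding_pair_le (fun n => 2 / N%:R * (N - n)%:R^-1)).
    move=> n /andP[n0 nN]; rewrite mulrC; apply: ler_pM; rewrite ?ge0 //.
      exact: letter_abs_le2 (letter_nth _) _ _ n0 nN.
    exact: letter_abs_le_invC (letter_nth _) _ n0 nN.
  by rewrite -mulr_sumr harmonic_sum_rev.
have wi'1 : W`_i' != 1 by rewrite wi'0 eq_sym oner_eq0.
have [wi0|wi0] := eqVneq W`_i 0.
  (* Letters (0, 0): the first letter is not 0, so it stands before [i], and its variable, being at
     most n, sums to at most n/(N - n). *)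
  pose j := Ordinal m0.
  have wj : W`_j != 0 by move: hW; rewrite -nth0.
  apply: (@colliding_triple_le j (fun n => (N - n)%:R^-1) (fun n => n%:R^-1)).
  - by apply: contraNneq wj => ->; rewrite wi0.
  - by apply: contraNneq wj => ->; rewrite wi'0.
  - by move=> n /andP[n0 nN]; apply: ler_pM; rewrite ?ge0 //;
      apply: letter_abs_le_inv (letter_nth _) _ n0 nN.
  - move=> n n0N; rewrite invrK; apply: window_sum_head => //.
    by rewrite lt0n; apply: contraNneq wj => ji; rewrite -[X in _`_X]ji wi0.
  - by move=> n /andP[n0 nN]; split; [apply: inv_gt0 | rewrite mulrC].
(* Letters (u, 0) with u neither 0 nor 1. *)
apply: (@colliding_pair_le (fun n => 2 / N%:R * n%:R^-1)).
  move=> n /andP[n0 nN]; apply: ler_pM; rewrite ?ge0 //.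
    exact: letter_abs_le2 (letter_nth _) _ _ n0 nN.
  exact: letter_abs_le_inv (letter_nth _) _ n0 nN.
by rewrite -mulr_sumr.
Qed.
End Collision.
End Collisions.

(** * Comparison of the sums under the two order conditions *)

Section StepDifference.
Variable R : realType.
Implicit Types (k : seq nat) (z W : seq R[i]).

Lemma eq_sorted_nth (T : Type) (x0 : T) (e e' : rel T) s :
  (forall i, (i.+1 < size s)%N ->
    e (nth x0 s i) (nth x0 s i.+1) = e' (nth x0 s i) (nth x0 s i.+1)) ->
  sorted e s = sorted e' s.
Proof.
by move=> ee'; apply/(sortedP x0)/(sortedP x0) => h i si;
  rewrite ?ee' ?h // -ee' ?h.
Qed.

Lemma sorted_zip_leq (e : rel (R[i] * nat)) W n : size W = size n ->
  (forall p q, e p q -> (p.2 <= q.2)%N) ->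
  sorted e (zip W n) -> sorted leq n.
Proof.
move=> sWn e_leq /(sub_sorted e_leq) h.
by rewrite -(unzip2_zip (s := W) (t := n)) ?sWn // sorted_map.
Qed.

Lemma step_leq (p q : R[i] * nat) : step p q -> (p.2 <= q.2)%N.
Proof. by rewrite /step; case: ifP => // _ /ltnW. Qed.

Lemma dual_step_leq (p q : R[i] * nat) : dual_step p q -> (p.2 <= q.2)%N.
Proof. by rewrite /dual_step; case: ifP => // _ /ltnW. Qed.

Definition clash W m (p : 'I_m * 'I_m) : bool :=
  (p.2 == p.1.+1 :> nat) && ((W`_p.1 == 1) != (W`_p.2 == 0)).

(** Weak and strict inequality agree on distinct values, so the two conditions can only disagree at
    equal neighbours for which exactly one of them is weak. *)
Lemma sorted_step_neq m N W (t : m.-tuple 'I_N) : size W = m ->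
  let s := zip W (map val t) in sorted step s != sorted dual_step s ->
  exists2 p : 'I_m * 'I_m, clash W p & tnth t p.1 == tnth t p.2.
Proof.
move=> sW s; apply: contraNP => nex; apply/eqP.
have ss : size s = m by rewrite size_zip size_map size_tuple sW minnn.
apply: (eq_sorted_nth (x0 := (0, 0%N))) => j; rewrite ss => jm.
pose i := Ordinal (ltnW jm); pose i' := Ordinal jm.
have nthE (l : 'I_m) : nth (0, 0%N) s l = (W`_l, val (tnth t l)).
  rewrite nth_zip ?size_map ?size_tuple //.
  by rewrite (nth_map (tnth t l)) ?size_tuple // -tnth_nth.
rewrite (nthE i) (nthE i') /step /dual_step /=.
have [->//|ne] := eqVneq (W`_j == 1) (W`_j.+1 == 0).
have : tnth t i != tnth t i'.
  by apply: contra_notN nex => e; exists (i, i'); rewrite // /clash eqxx.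
by rewrite -val_eqE /= => tne; rewrite leq_eqVlt (negPf tne) !if_same.
Qed.

(** A tuple counted in only one sum collides at some clash. Summing over all pairs of positions
    bounds the difference by the collision estimates. *)
Lemma word_sum_step_diff m N W : size W = m -> all letter W ->
  head 0 W != 0 -> last 0 W != 1 -> (1 < N)%N ->
  `|word_sum step m W N - word_sum dual_step m W N| <=
  #|{: 'I_m * 'I_m}|%:R * (2 / N%:R * harmonic_sum R[i] N ^+ m).
Proof.
move=> sW lW hW tW N1; rewrite /word_sum big_mkcond [X in _ - X]big_mkcond /=.
rewrite -sumrB; apply: le_trans (ler_norm_sum _ _ _) _.
pose c (t : m.-tuple 'I_N) (p : 'I_m * 'I_m) : R[i] :=
  if clash W p && colliding p.1 p.2 t then `|word_term N W (map val t)| else 0.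
have c0 t p : 0 <= c t p by rewrite /c; case: ifP.
apply: (@le_trans _ _ (\sum_(t : m.-tuple 'I_N) \sum_p c t p)).
  apply: ler_sum => t _; case: (boolP (all _ _)) => t0 /=; last first.
    by rewrite subrr normr0 sumr_ge0.
  have [->|ne] := eqVneq (sorted step (zip W (map val t)))
                         (sorted dual_step (zip W (map val t))).
    by rewrite subrr normr0 sumr_ge0.
  have [p clp tp] := sorted_step_neq sW ne.
  rewrite (bigD1 p) //= ler_wpDr ?sumr_ge0 // /c clp /colliding t0 tp andbT.
  have swt : size W = size (map val t) by rewrite size_map size_tuple.
  (* One of the two conditions holds because they disagree, and either implies weak monotonicity. *)
  have -> /= : sorted leq (map val t).
    case: (boolP (sorted step _)) ne => [st _|_ ne].
      exact: sorted_zip_leq swt step_leq st.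
    apply: (sorted_zip_leq swt dual_step_leq).
    by case: (sorted dual_step _) ne.
  by move: ne; case: ifP; case: ifP => // _ _ _; rewrite ?subr0 // sub0r normrN.
rewrite exchange_big -sum1_card natr_sum mulr_suml; apply: ler_sum => p _.
rewrite mul1r /c; case: (boolP (clash W p)) => [/andP[/eqP ii' cl]|_].
  by rewrite -big_mkcond; apply: colliding_le.
rewrite big1 // mulr_ge0 ?divr_ge0 ?exprn_ge0 //.
exact: le_trans ler01 (harmonic_sum_ge1 _ N1).
Qed.
End StepDifference.

(** * Harmonic sums and the logarithm *)

Section Logarithm.
Variable R : realType.

Lemma harmonic_sum_le_ln N : (0 < N)%N ->
  harmonic_sum R N <= 1 + ln N%:R.
Proof.
(* The term 1/N is added before the induction: the increment ln (N + 1) - ln N dominates 1/(N + 1),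
   by ln (1 - x) <= -x, but not 1/N. *)
move=> N0; apply: (@le_trans _ _ (harmonic_sum R N.+1)).
  by rewrite /harmonic_sum big_nat_recr //= lerDl invr_ge0 ler0n.
case: N N0 => // N _; elim: N => [|N IH].
  by rewrite /harmonic_sum big_nat1 ln1 invr1 addr0.
rewrite /harmonic_sum big_nat_recr //= -/(harmonic_sum R N.+2).
apply: le_trans (lerD IH (lexx _)) _; rewrite -addrA lerD2l -lerBrDl.
have NS : (N.+2%:R : R) != 0 by rewrite pnatr_eq0.
have -> : ln N.+1%:R = ln N.+2%:R + ln (1 - N.+2%:R^-1) :> R.
  have -> : 1 - N.+2%:R^-1 = N.+1%:R / N.+2%:R :> R.
    by rewrite -[in RHS](addrK 1 N.+1%:R) natr1 mulrBl divff // mul1r.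
  rewrite lnM ?posrE ?invr_gt0 ?ltr0n // lnV ?posrE ?ltr0n //.
  by rewrite addrCA subrr addr0.
rewrite opprD addNKr lerNr; apply: le_ln1Dx.
by rewrite ltrN2 invf_lt1 ?ltr1n ?ltr0n.
Qed.

Lemma real_complex_harmonic_sum N :
  harmonic_sum R[i] N = (harmonic_sum R N)%:C.
Proof.
rewrite /harmonic_sum rmorph_sum; apply: eq_bigr => x _ /=.
by rewrite fmorphV rmorph_nat.
Qed.
End Logarithm.

(** * The dual pair as an index pair with reflected word *)

Section DualPairs.
Variable R : realType.
Implicit Types (k l : seq nat) (z : seq R[i]) (s : seq (block R)).

Lemma all_flatten (T : Type) (a : pred T) (ss : seq (seq T)) :
  all a (flatten ss) = all (all a) ss.
Proof. by elim: ss => //= s ss IH; rewrite all_cat IH. Qed.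

Lemma is_index_dual_index l : is_index (dual_index l).
Proof.
rewrite /dual_index /is_index; elim: [seq (p.2, p.1) | p <- _] => //= p s IH.
by rewrite all_cat all_rcons all_nseq /= IH orbT.
Qed.

Lemma is_index_dual_blocks s l : all (@valid_block R) s ->
  is_index (dual_blocks_k s l).
Proof.
move=> vs; rewrite /is_index all_cat -/(is_index _) is_index_dual_index /=.
rewrite all_flatten all_map all_rev; apply: sub_all vs => x /and4P[_ a0 _ _] /=.
by rewrite all_cat all_rcons all_nseq a0 orbT; apply: is_index_dual_index.
Qed.

Lemma dual_blocks_z_neq0 s l : all (@valid_block R) s ->
  0 \notin dual_blocks_z s l.
Proof.
move=> vs; rewrite -has_pred1 -all_predC all_cat all_nseq /= oner_eq0 orbT /=.
rewrite all_flatten all_map all_rev; apply: sub_all vs => x /and4P[_ _ _ w1].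
rewrite inE all_cat all_rcons !all_nseq /= oner_eq0 !orbT !andbT.
by rewrite subr_eq0 eq_sym.
Qed.

Lemma dual_pair_word k z k' z' : dual_pair k z k' z' ->
  [/\ is_index k', size z' = size k', 0 \notin z' &
      word k' z' = dual_word (word k z)].
Proof.
move=> [s [l [[vs al -> ->] -> ->]]]; split.
- exact: is_index_dual_blocks.
- by rewrite size_dual_blocks.
- exact: dual_blocks_z_neq0.
- exact: word_dual_blocks.
Qed.
End DualPairs.

(** * The asymptotic duality *)

Local Open Scope classical_set_scope.

Unset Implicit Arguments.

Theorem theorem4p4 (R : realType) (k : seq nat) (z : seq R[i])
    (k' : seq nat) (z' : seq R[i])
    (hkz : dual_condition k z) (hdual : dual_pair k z k' z') :
  (fun N : nat => I_sum k' z' N : R[i]^o) =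
    (fun N : nat => (-1) ^+ wt k * I_sum k z N : R[i]^o)
      +O_\oo (fun N : nat => (N%:R^-1 * ln N%:R ^+ wt k)%:C : R[i]^o).
Proof.
have [/eqP k0 ik sz Bz _] := hkz.
have [ik' sz' z'0 wd] := dual_pair_word hdual.
have z0 : 0 \notin z by apply/negP => /(allP Bz); rewrite in_B0.
set m := wt k; set W := word k z.
have sW : size W = m by apply: size_word.
have wt' : wt k' = m.
  by rewrite -(size_word ik' sz') wd size_rev size_map.
(* The factors are the number of pairs of positions, the 2 of 2/N, and 2^m from H <= 1 + ln N <= 2
   ln N. *)
pose K : R[i] := #|{: 'I_m * 'I_m}|%:R * (2 * 2 ^+ m).
apply/eqaddOP; near=> c; near=> N.
have N1 : (1 < N)%N by near: N; exists 2%N.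
(* This holds once N >= e, and it absorbs the 1 in 1 + ln N. *)
have lnN : 1 <= ln N%:R :> R.
  rewrite -[leLHS](expRK 1) ler_ln ?posrE ?expR_gt0 ?ltr0n ?(ltnW N1) //.
  by near: N; apply: nbhs_infty_ger.
have -> : ((fun N => I_sum k' z' N : R[i]^o) -
    (fun N => (-1) ^+ m * I_sum k z N : R[i]^o)) N =
    (-1) ^+ m * (word_sum dual_step m W N - word_sum step m W N).
  transitivity (I_sum k' z' N - (-1) ^+ m * I_sum k z N); first by [].
  rewrite (I_sum_word N ik' sz' z'0 wt') (I_sum_word N ik sz z0 erefl) wd.
  by rewrite -(prednK (ltnW N1)) word_sum_dual // mulrBr.
rewrite normrM normrX normrN1 expr1n mul1r distrC.
apply: le_trans (word_sum_step_diff sW _ _ _ N1) _.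
- exact: word_letters.
- exact: word_head.
- exact: word_last.
have N0 : 0 < N%:R :> R by rewrite ltr0n ltnW.
have g0 : 0 <= (N%:R^-1 * ln N%:R ^+ m)%:C :> R[i].
  by rewrite ler0c mulr_ge0 ?invr_ge0 ?(ltW N0) // exprn_ge0 // (le_trans ler01).
rewrite ger0_norm //; apply: (@le_trans _ _ (K * (N%:R^-1 * ln N%:R ^+ m)%:C)).
  rewrite /K -!mulrA; do 2 apply: ler_wpM2l => //.
  rewrite rmorphM /= fmorphV rmorph_nat mulrCA; apply: ler_wpM2l.
    by rewrite invr_ge0 ler0n.
  rewrite rmorphXn /= -exprMn; apply: lerXn2r.
  - by rewrite nnegrE (le_trans ler01) ?harmonic_sum_ge1.
  - by rewrite nnegrE mulr_ge0 // ler0c (le_trans ler01).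
  rewrite real_complex_harmonic_sum -[2](rmorph_nat (@real_complex R)) -rmorphM.
  rewrite lecR; apply: le_trans (harmonic_sum_le_ln _ (ltnW N1)) _.
  by rewrite mulr_natl mulr2n lerD2r.
apply: ler_wpM2r => //; near: c; apply: nbhs_pinfty_ge.
by rewrite /K ger0_real.
Unshelve. all: by end_near.
Qed.
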